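(* Let $\mathcal{H}$ be a complex separable Hilbert space, let $K$ be a bounded linear operator on $\mathcal{H}$ with closed range, and let $m\in\mathbb{N}$. For each $i\in[m]=\{1,\dots,m\}$, suppose $\{\phi_{ij}\}_{j=1}^\infty$ is a $K$-frame for $\mathcal{H}$ with bounds $A_i$ and $B_i$. Assume that for any partition $\{\tau_i\}_{i\in[m]}$ of a finite subset of $\mathbb{N}$ and for every $A>0$ there exists a partition $\{\sigma_i\}_{i\in[m]}$ of $\mathbb{N}\setminus\bigcup_{i\in[m]}\tau_i$ such that $\bigcup_{i\in[m]}\{\phi_{ij}\}_{j\in\sigma_i\cup\tau_i}$ has optimal lower $K$-frame bound less than $A$, i.e. there exists $h\in\mathcal{H}$ with $$\sum_{i\in[m]}\sum_{j\in\sigma_i\cup\tau_i}|\langle h,\phi_{ij}\rangle|^2<A\|K^*h\|^2.$$ Then there exists a partition $\{\pi_i\}_{i\in[m]}$ of $\mathbb{N}$ such that $\bigcup_{i\in[m]}\{\phi_{ij}\}_{j\in\pi_i}$ is not a $K$-frame for $\mathcal{H}$.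
   Context: A sequence $\{f_k\}_{k=1}^\infty\subset\mathcal{H}$ is a $K$-frame for $\mathcal{H}$ with lower bound $A>0$ and upper bound $B>0$ if $A\|K^*f\|^2\le\sum_{k=1}^\infty|\langle f,f_k\rangle|^2\le B\|f\|^2$ for all $f\in\mathcal{H}$. It is a $K$-frame if such constants exist. A partition $\{\sigma_i\}_{i\in[m]}$ of a set consists of pairwise disjoint, possibly empty, sets whose union is that set; the finite subset of $\mathbb{N}$ may be empty. The union $\bigcup_{i\in[m]}\{\phi_{ij}\}_{j\in\sigma_i}$ is understood as an indexed family (with multiplicity). *)

(* Defs.v *)
From HB Require Import structures.
From mathcomp Require Import all_boot all_order all_algebra.
From mathcomp Require Import complex.
From mathcomp Require Import all_classical all_reals all_analysis.

Set Implicit Arguments.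
Unset Strict Implicit.
Unset Printing Implicit Defensive.

Import Order.TTheory GRing.Theory Num.Theory.
Import numFieldNormedType.Exports.

Local Open Scope classical_set_scope.
Local Open Scope ring_scope.

(* Unlike [partition] of [classical_sets], the blocks may be empty. *)
Definition is_partition (I T : Type) (P : I -> set T) (X : set T) : Prop :=
  trivIset [set: I] P /\ \bigcup_i P i = X.

Definition separable (T : topologicalType) : Prop :=
  exists2 D : set T, countable D & dense D.

Section KFrames.
Variables (R : realType) (H : normedModType R[i]).
Implicit Types (form : {dot H for (@Num.conj R[i])}) (K : H -> H).

(* The norm of a normed space over R[i] (and the modulus on R[i]) takes its
   values in R[i]; [complex.Re] brings them back to R. *)
Definition normR (x : H) : R := complex.Re `|x|.

Definition is_inner_product_norm form : Prop :=
  forall x : H, `|x| ^+ 2 = form x x.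

(* K^* y is the vector z such that <K x, y> = <x, z> for all x: by Riesz's
   theorem it exists when K is bounded linear and H is complete; the default 0
   is never used in that case. *)
Definition adjoint form K (y : H) : H :=
  xget 0 [set z | forall x, form (K x) y = form x z].

Lemma adjoint_unique form K (T : H -> H) :
  (forall x y, form (K x) y = form x (T y)) -> adjoint form K = T.
Proof.
move=> KT; apply/funext => y; apply: xget_unique => [x|z Kz]; first exact: KT.
apply/eqP; rewrite -subr_eq0 -(dnorm_eq0 form).
by rewrite (linearB (form (z - T y))) /= -Kz -KT subrr.
Qed.

(* Families are indexed by a set S of indices, so that vectors count with
   multiplicity; the terms are nonnegative, so their unordered sum in \bar R
   is the sum of the series. *)
Definition frame_sum form (I : choiceType) (S : set I) (f : I -> H) (h : H)
    : \bar R :=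
  \esum_(i in S) (complex.Re `|form h (f i)| ^+ 2)%:E.

Definition Kframe_with_bounds form K (I : choiceType) (S : set I) (f : I -> H)
    (A B : R) : Prop :=
  [/\ 0 < A, 0 < B &
    forall h : H,
      ((A * normR (adjoint form K h) ^+ 2)%:E <= frame_sum form S f h)%E /\
      (frame_sum form S f h <= (B * normR h ^+ 2)%:E)%E].

Definition is_Kframe form K (I : choiceType) (S : set I) (f : I -> H) : Prop :=
  exists A B : R, Kframe_with_bounds form K S f A B.

End KFrames.

(* Index set of the family {phi i j : j in P i}, i ranging over 'I_m. *)
Definition union_index (m : nat) (P : 'I_m -> set nat) : set ('I_m * nat) :=
  [set p | P p.1 p.2].

(* Main.v *)
Require Import Defs.
From HB Require Import structures.
From mathcomp Require Import all_boot all_order all_algebra.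
From mathcomp Require Import complex.
From mathcomp Require Import all_classical all_reals all_analysis.

Set Implicit Arguments.
Unset Strict Implicit.
Unset Printing Implicit Defensive.

Import Order.TTheory GRing.Theory Num.Theory.
Import numFieldNormedType.Exports.

Local Open Scope classical_set_scope.
Local Open Scope ring_scope.

(** A partition of the naturals into [m] blocks is a colouring
    [c : nat -> 'I_m], and its woven family gives at [h] the single series
    [\sum_j |<h, phi (c j) j>|^2].  The theorem is then a Baire category
    argument in the product space of colourings.

    Say that [c] is [k]-small if, for some [h], this series is less than
    [||K^* h||^2 / (k + 1)].
    - The [k]-small colourings form an open set: the upper frame bounds make
      [\sum_i \sum_j |<h, phi i j>|^2] converge, so changing the colours of all
      indices beyond a large [n] moves the series at the witness [h] by as
      little as desired ([woven_sum_lt_open]).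
    - They form a dense set: the hypothesis, applied to the partition that [c]
      induces on the integers below [n] and to [a = 1 / (k + 1)], extends this
      finite partition to a [k]-small colouring.

    Hence one colouring is [k]-small for every [k] ([baire_sequences]), which
    leaves no room for a positive lower frame bound. *)

Definition agree_below (T : Type) (n : nat) (c d : nat -> T) : Prop :=
  forall j, (j < n)%N -> c j = d j.

(** The Baire category theorem for sequences in a discrete space, where the
    basic open sets fix a finite prefix.  Nested prefixes of strictly increasing
    length, the [k]-th of which forces [Q k], have a common extension. *)
Lemma baire_sequences (T : Type) (Q : nat -> (nat -> T) -> Prop)
    (c0 : nat -> T) :
  (forall k n c, exists c' n', agree_below n c c' /\
     forall d, agree_below n' c' d -> Q k d) ->
  exists d, forall k, Q k d.
Proof.
move=> dense_open.
(* A state is a stage number, the length of the prefix fixed so far, and a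
   sequence carrying this prefix. *)
pose step (x y : nat * nat * (nat -> T)) :=
  [/\ y.1.1 = x.1.1.+1, (x.1.2 < y.1.2)%N, agree_below x.1.2 x.2 y.2 &
      forall d, agree_below y.1.2 y.2 d -> Q x.1.1 d].
have step_total x : {y | step x y}.
  apply: cid; have [c' [n' [cc' Qc']]] := dense_open x.1.1 x.1.2 x.2.
  exists (x.1.1.+1, maxn n' x.1.2.+1, c'); split => //= [|d c'd].
    by rewrite leq_max leqnn orbT.
  by apply: Qc' => j jn'; apply: c'd; rewrite leq_max jn'.
have [s [s0 sS]] := dependent_choice step_total (0%N, 0%N, c0).
have s_index k : (s k).1.1 = k.
  by elim: k => [|k IHk]; [rewrite s0 | have [-> _ _ _] := sS k; rewrite IHk].
have s_bound k : (k <= (s k).1.2)%N.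
  elim: k => // k IHk; have [_ lt_s _ _] := sS k.
  exact: leq_ltn_trans IHk lt_s.
have s_agree k l : agree_below (s k).1.2 (s k).2 (s (k + l)%N).2 /\
    ((s k).1.2 <= (s (k + l)%N).1.2)%N.
  elim: l => [|l [IHagree IHle]]; first by rewrite addn0.
  rewrite addnS; have [_ /ltnW lt_s agree _] := sS (k + l)%N.
  split=> [j jk|]; last exact: leq_trans lt_s.
  by rewrite IHagree// agree// (leq_trans jk).
(* The prefix fixed at stage j.+1 has length at least j.+1, so it determines
   the entry of index j. *)
exists (fun j => (s j.+1).2 j) => k.
have [_ _ _] := sS k; rewrite s_index; apply => j jk.
have [kj|/ltnW jk'] := leqP k.+1 j.+1.
  by have [+ _] := s_agree k.+1 (j.+1 - k.+1)%N; rewrite subnKC//; apply.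
have [+ _] := s_agree j.+1 (k.+1 - j.+1)%N; rewrite subnKC// => -> //.
Qed.

Lemma nneseries_tail_lt (R : realType) (f : nat -> \bar R) (e : R) :
  (forall j, 0 <= f j)%E -> (\sum_(0 <= j <oo) f j < +oo)%E -> 0 < e ->
  exists n, (\sum_(n <= j <oo) f j < e%:E)%E.
Proof.
move=> f_ge0 f_fin e_gt0.
have f_cvg := nneseries_tail_cvg f_fin (fun j _ => f_ge0 j).
have [n _ tail_lt] : \forall n \near \oo, (\sum_(n <= j <oo) f j < e%:E)%E.
  apply: (f_cvg [set x | (x < e%:E)%E]); apply: open_nbhs_nbhs.
  split; first exact: open_ereal_lt_ereal.
  by rewrite /= lte_fin.
by exists n; apply: tail_lt => /=.
Qed.

Section Weaving.
Variables (R : realType) (I : finType).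
Implicit Types (a : I -> nat -> \bar R) (c : nat -> I) (S : I -> set nat).

(** With [a i j = |<h, phi i j>|^2], this is the sum at [h] of the frame woven
    along [c], arranged as a series over the naturals so that heads and tails of
    two colourings can be compared. *)
Definition woven_sum a c : \bar R := (\sum_(0 <= j <oo) a (c j) j)%E.

(** The sets [S i] may overlap or contain further indices, which only increases
    the right-hand side. *)
Lemma woven_sum_le_esum a S c :
  (forall i j, 0 <= a i j)%E -> (forall j, S (c j) j) ->
  (woven_sum a c <= \sum_i \esum_(j in S i) a i j)%E.
Proof.
move=> a_ge0 Sc.
under eq_bigr => i _ do rewrite esum_mkcond.
rewrite -esum_sum; last by move=> j i _ _; case: ifP.
rewrite /woven_sum nneseries_esumT//; apply: le_esum => j _.
rewrite (bigD1 (c j))//= mem_set ?leeDl//.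
by apply: sume_ge0 => i _; case: ifP.
Qed.

Lemma esum_union_color a c :
  (forall i j, 0 <= a i j)%E ->
  \esum_(p in [set p | c p.2 = p.1]) a p.1 p.2 = woven_sum a c.
Proof.
move=> a_ge0; rewrite /woven_sum nneseries_esumT//.
rewrite -(esum_image [set: nat] (fun j => (c j, j))
  (fun p => a p.1 p.2)); last by move=> j k _ _ [_].
congr esum; apply/seteqP; split=> [[i j] /= <-|_ [j _ <-]//].
by exists j.
Qed.

(** Beyond [n], every woven tail is dominated by the tail of the convergent
    series with terms [\sum_i a i j], uniformly in the colouring [d].  Taking
    this tail below the gap [x - woven_sum a c] keeps the strict inequality. *)
Lemma woven_sum_lt_open a c (x : R) :
  (forall i j, 0 <= a i j)%E ->
  (forall i, \sum_(0 <= j <oo) a i j < +oo)%E ->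
  (woven_sum a c < x%:E)%E ->
  exists n, forall d, agree_below n c d -> (woven_sum a d < x%:E)%E.
Proof.
move=> a_ge0 a_fin ltx.
have suma_ge0 j : (0 <= \sum_i a i j)%E by apply: sume_ge0.
have suma_fin : (\sum_(0 <= j <oo) \sum_i a i j < +oo)%E.
  by rewrite nneseries_sum//; apply: lte_sum_pinfty.
have wc_fin : woven_sum a c \is a fin_num.
  rewrite ge0_fin_numE ?(lt_trans ltx) ?ltry//.
  exact: nneseries_ge0.
have e_gt0 : 0 < x - fine (woven_sum a c).
  by rewrite subr_gt0 -lte_fin fineK.
have [n tail_lt] := nneseries_tail_lt suma_ge0 suma_fin e_gt0.
exists n => d cd.
have head_le : (\sum_(0 <= j < n) a (d j) j <= woven_sum a c)%E.
  rewrite /woven_sum (nneseries_split 0 n)// add0n.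
  rewrite [leLHS](_ : _ = \sum_(0 <= j < n) a (c j) j)%E.
    by rewrite leeDl// nneseries_ge0.
  by apply: eq_big_nat => j /andP[_ jn]; rewrite cd.
have tail_le : (\sum_(n <= j <oo) a (d j) j <=
    \sum_(n <= j <oo) \sum_i a i j)%E.
  apply: lee_nneseries => // j _.
  by rewrite (bigD1 (d j))//= leeDl// sume_ge0.
rewrite {1}/woven_sum (nneseries_split 0 n)// add0n.
rewrite (le_lt_trans (leeD head_le tail_le))//.
by rewrite -lteBrDl// -[woven_sum a c]fineK.
Qed.

End Weaving.

Theorem theorem2p6 (R : realType) (H : completeNormedModType R[i])
    (form : {dot H for (@Num.conj R[i])})
    (form_norm : is_inner_product_norm form)
    (H_separable : separable H)
    (K : {linear H -> H})
    (K_bounded : bounded_near (K : H -> H) (nbhs (0 : H)))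
    (K_closed_range : closed (range K))
    (m : nat) (m_gt0 : (0 < m)%N)
    (phi : 'I_m -> nat -> H) (A B : 'I_m -> R)
    (phi_Kframe : forall i : 'I_m,
      Kframe_with_bounds form K [set: nat] (phi i) (A i) (B i))
    (bad_partition : forall (F : set nat) (tau : 'I_m -> set nat),
      finite_set F -> is_partition tau F ->
      forall a : R, 0 < a ->
      exists sigma : 'I_m -> set nat,
        is_partition sigma ([set: nat] `\` \bigcup_i tau i) /\
        exists h : H,
          (\sum_(i < m) frame_sum form (sigma i `|` tau i) (phi i) h
            < (a * normR (adjoint form K h) ^+ 2)%:E)%E) :
  exists P : 'I_m -> set nat,
    is_partition P [set: nat] /\
    ~ is_Kframe form K (union_index P) (fun p => phi p.1 p.2).
Proof.
pose a h i j : \bar R := (complex.Re `|form h (phi i j)| ^+ 2)%:E.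
have a_ge0 h i j : (0 <= a h i j)%E by rewrite lee_fin sqr_ge0.
have a_fin h i : (\sum_(0 <= j <oo) a h i j < +oo)%E.
  have [_ _ /(_ h)[_ upper]] := phi_Kframe i.
  rewrite nneseries_esumT//; exact: le_lt_trans upper (ltry _).
pose small k (c : nat -> 'I_m) := exists h,
  (woven_sum (a h) c < (k.+1%:R^-1 * normR (adjoint form K h) ^+ 2)%:E)%E.
have [|c small_c] := @baire_sequences _ small (fun=> Ordinal m_gt0).
  move=> k n c.
  pose tau i := [set j | (j < n)%N /\ c j = i].
  have tau_part : is_partition tau `I_n.
    split; first by move=> i i' _ _ [j [[_ <-] [_ <-]]].
    by apply/seteqP; split=> [j [i _ []]//|j /= jn]; exists (c j).
  (* Recolouring the indices from n on by the blocks of sigma gives a small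
     colouring with the same prefix as c. *)
  have [sigma [[_ sigma_cover] [h h_lt]]] :=
    bad_partition _ tau (finite_II n) tau_part k.+1%:R^-1 ltac:(by []).
  have color j : exists i, (sigma i `|` tau i) j /\ ((j < n)%N -> c j = i).
    have [jn|nj] := ltnP j n; first by exists (c j); split; [right|].
    have : (\bigcup_i sigma i) j.
      rewrite sigma_cover; split=> // -[i _ [jn _]].
      by move: nj; rewrite leqNgt jn.
    by case=> i _ sij; exists i; split; [left|].
  have [c' c'P] := choice color.
  have c'_lt : (woven_sum (a h) c' <
      (k.+1%:R^-1 * normR (adjoint form K h) ^+ 2)%:E)%E.
    apply: le_lt_trans h_lt; apply: woven_sum_le_esum => // j.
    by have [] := c'P j.
  have [n' n'P] := woven_sum_lt_open (a_ge0 h) (a_fin h) c'_lt.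
  exists c', n'; split=> [j jn|d c'd]; last by exists h; apply: n'P.
  by have [_ ->] := c'P j.
exists (fun i => [set j | c j = i]); split.
  split; first by move=> i i' _ _ [j [<- <-]].
  by apply/seteqP; split=> // j _; exists (c j).
move=> [A0 [B0 [A0_gt0 _ frame]]].
have [k k_lt] := ltr_add_invr A0_gt0.
have [h h_lt] := small_c k.
have [lower _] := frame h.
have := le_lt_trans lower (_ : (_ < _)%E).
rewrite /frame_sum (esum_union_color c (a_ge0 h)) => /(_ _ h_lt).
rewrite lte_fin ltNge ler_wpM2r ?sqr_ge0// ltW//.
by rewrite add0r in k_lt.
Qed.
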